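(* Let $x>0$ be irrational and let $q>0$ be real. There exists a unique Borel probability measure $\mu_{x,q}$ on $\mathcal{F}_x$ such that for every integer $k\ge 0$ and every atomic cylinder event $E$ on $0,\dots,k$, $$\mu_{x,q}(E)=\frac{\rho(E)}{\sum_{F}\rho(F)},$$ where the sum ranges over all atomic cylinder events $F$ on $0,\dots,k$, and $\rho$ denotes the limit ratios (relative to a fixed atomic cylinder event $E_0$ on $0,\dots,k$) obtained from finite snakes agreeing with the infinite snake $S_x$ on longer and longer initial blocks, as defined in the context.
   Context: Snake posets. A snake poset is a poset on $\{0,1,\dots,m\}$ (finite case) or on $\{0,1,2,\dots\}$ (infinite case) such that for each $i$ (with $i<m$ in the finite case) exactly one of $i+1\lessdot i$ or $i+1\gtrdot i$ is prescribed ($\lessdot$ = ''is covered by'', $\gtrdot$ = ''covers''), with no relations other than those implied by these. A filter of a poset is an up-closed subset. Infinite snake. For irrational $x>0$ with continued fraction $x=[c_1;c_2,c_3,\dots]$, $c_1\ge 0$ and $c_i\ge 1$ for $i>1$, $S_x$ is the infinite snake poset on $\{0,1,2,\dots\}$ whose steps $0\to1\to2\to\cdots$ are: $c_1$ downward steps, then $c_2$ upward steps, then $c_3$ downward steps, then $c_4$ upward steps, and so on, alternating; the step from $i$ to $i+1$ is downward if $i+1\lessdot i$ and upward if $i+1\gtrdot i$. $\mathcal{F}_x$ is the set of filters of $S_x$, viewed as a (closed) subset of $\{0,1\}^{\mathbb{N}}$ with the product topology. Finite measures. For a finite snake poset $S$, $\mu_{S,q}$ is the probability measure on filters of $S$ in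 which a filter $F$ has probability proportional to $q^{|F|}$. Atomic cylinder events. For $k\ge0$, an atomic cylinder event on $0,\dots,k$ is an event of the form $\{F: F\cap\{0,\dots,k\}=A\}$, where $A$ is a prescribed filter of the induced subposet of $S_x$ on the vertices $0,\dots,k$. (The same formula defines the event for any finite snake agreeing with $S_x$ on vertices $0,\dots,k$.) Limits. Fix $k$ and one atomic cylinder event $E_0$ on $0,\dots,k$. For an atomic cylinder event $E$ on $0,\dots,k$, $$\rho(E)=\lim_{\ell\to\infty}\frac{\mu_{S,q}(E)}{\mu_{S,q}(E_0)},$$ where $S$ is any finite snake poset on $\{0,\dots,m\}$, $m>\ell>k$, agreeing with $S_x$ on the vertices $0,\dots,\ell$. The limit exists and is independent of the choice of continuation beyond $\ell$: for every $\varepsilon>0$ there is $\ell_0$ such that for all $\ell\ge\ell_0$ and every such $S$ the ratio is within $\varepsilon$ of $\rho(E)$. *)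

(* Defs.v *)
From HB Require Import structures.
From mathcomp Require Import all_boot all_order all_algebra.
From mathcomp Require Import all_classical all_reals all_analysis.

Set Implicit Arguments.
Unset Strict Implicit.
Unset Printing Implicit Defensive.

Import Order.TTheory GRing.Theory Num.Theory.

Local Open Scope classical_set_scope.
Local Open Scope ring_scope.

(* x = [cf x 0; cf x 1, cf x 2, ...] for x > 0 irrational, obtained by the
   usual algorithm; indices start at 0, so c_n is cf x n.-1. *)
Definition complete_quotient (R : realType) (x : R) (n : nat) : R :=
  iter n (fun y => (y - (Num.floor y)%:~R)^-1) x.

Definition cf (R : realType) (x : R) (n : nat) : nat :=
  Num.truncn (complete_quotient x n).

(* An infinite snake is given by d : nat -> bool, where d i = true means that
   the step from i to i.+1 is downward and d i = false that it is upward.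
   A finite snake on {0, ..., m} is given by m and such a d, of which only the
   values d i with i < m matter. *)

(* i is covered by j *)
Definition snake_cover (d : nat -> bool) (i j : nat) : bool :=
  ((i == j.+1) && d j) || ((j == i.+1) && ~~ d i).

Definition snake_le (d : nat -> bool) (i j : nat) : Prop :=
  exists2 p : seq nat, path (snake_cover d) i p & j = last i p.

Definition fin_snake_le (m : nat) (d : nat -> bool) : rel 'I_m.+1 :=
  connect (fun i j : 'I_m.+1 => snake_cover d i j).

Definition snake_filter (d : nat -> bool) : set cantor_space :=
  [set F : nat -> bool | forall i j, F i -> snake_le d i j -> F j].

Definition fin_snake_filter (m : nat) (d : nat -> bool) : pred {set 'I_m.+1} :=
  fun F => [forall i, forall j, (i \in F) && fin_snake_le d i j ==> (j \in F)].

(* The filters of the subposet induced on {0, ..., k} by the infinite snake d;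
   they index the atomic cylinder events on 0, ..., k. *)
Definition atom (k : nat) (d : nat -> bool) : pred {set 'I_k.+1} :=
  fun A => `[< forall i j : 'I_k.+1, i \in A -> snake_le d i j -> j \in A >].

(* Step i lies in block n when c_1 + ... + c_n <= i < c_1 + ... + c_n.+1;
   blocks 0, 2, 4, ... are the downward ones. *)
Definition cf_snake (R : realType) (x : R) (i : nat) : bool :=
  `[< exists n, ~~ odd n /\
        (\sum_(j < n) cf x j <= i < \sum_(j < n.+1) cf x j)%N >].

Definition filter_space (d : nat -> bool) : Type := set_type (snake_filter d).

HB.instance Definition _ (d : nat -> bool) := Topological.on (filter_space d).

Lemma snake_filterT (d : nat -> bool) :
  (fun=> true : bool) \in snake_filter d.
Proof. exact/mem_set. Qed.

Definition full_filter (d : nat -> bool) : filter_space d :=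
  SigSub (snake_filterT d).

HB.instance Definition _ (d : nat -> bool) :=
  isPointed.Build (filter_space d) (full_filter d).

Definition borel_filter_space (d : nat -> bool) :=
  g_sigma_algebraType (@open (filter_space d)).

HB.instance Definition _ (d : nat -> bool) :=
  Measurable.on (borel_filter_space d).

(* F `&` {0, ..., k} *)
Definition snake_trace (k : nat) (F : nat -> bool) : {set 'I_k.+1} :=
  [set i : 'I_k.+1 | F i]%SET.

Definition cylinder (k : nat) (d : nat -> bool) (A : {set 'I_k.+1}) :
    set (filter_space d) :=
  [set F | snake_trace k (set_val F) = A].
Arguments cylinder {k} d A.

Definition fin_cylinder (k m : nat) (A : {set 'I_k.+1}) : pred {set 'I_m.+1} :=
  fun F => snake_trace k (fun i => inord i \in F) == A.

Definition fin_snake_prob (R : realType) (q : R) (m : nat) (d : nat -> bool)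
    (E : pred {set 'I_m.+1}) : R :=
  (\sum_(F | fin_snake_filter d F && E F) q ^+ #|F|) /
  (\sum_(F | @fin_snake_filter m d F) q ^+ #|F|).

(* The ratios mu_(S,q)(E) / mu_(S,q)(E0) converge to r as l tends to infinity,
   uniformly over the finite snakes S = (m, d') agreeing with the infinite snake
   d on the vertices 0, ..., l. *)
Definition ratio_cvg (R : realType) (q : R) (d : nat -> bool) (k : nat)
    (E0 E : {set 'I_k.+1}) (r : R) : Prop :=
  forall eps : R, 0 < eps -> exists l0 : nat,
  forall l : nat, (l0 <= l)%N -> (k < l)%N ->
  forall (m : nat) (d' : nat -> bool), (l < m)%N ->
    (forall i, (i < l)%N -> d' i = d i) ->
  `| fin_snake_prob q d' (@fin_cylinder k m E) /
     fin_snake_prob q d' (@fin_cylinder k m E0) - r | < eps.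

(* rho F is the limit of the ratios mu_(S,q)(F) / mu_(S,q)(E0) for every atom F
   on 0, ..., k; requiring its existence here avoids a default value. *)
Definition has_cylinder_law (R : realType) (q : R) (d : nat -> bool)
    (mu : set (borel_filter_space d) -> \bar R) : Prop :=
  forall (k : nat) (E0 : {set 'I_k.+1}), atom d E0 ->
  exists2 rho : {set 'I_k.+1} -> R,
    (forall F, atom d F -> ratio_cvg q d E0 F (rho F)) &
    (forall E, atom d E ->
      mu (cylinder d E) = (rho E / \sum_(F | atom d F) rho F)%:E).

(* Main.v *)
Require Import Defs.
From HB Require Import structures.
From mathcomp Require Import all_boot all_order all_algebra.
From mathcomp Require Import all_classical all_reals all_analysis.
From mathcomp Require Import zify ring lra.

(** A filter of a snake is a 0-1 word [f 0, f 1, ...] subject to one implication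
    between each pair of neighbours, so the measure proportional to [q ^ |F|] is
    a one-dimensional Markov chain and can be solved by transfer matrices.

    Fix a prefix on the vertices [0, ..., k].  Summing out everything to its
    right leaves a factor that depends on the prefix only through its last bit;
    let [r] be the quotient of the factors for last bit 1 and last bit 0.  One
    more vertex changes [r] by the Moebius map [step]: [r |-> 1 + q r] when the
    edge goes down and [r |-> q r / (1 + q r)] when it goes up.  Thus the
    measure of a prefix [f] in a finite snake is proportional to [weight r k f],
    which is [q ^ (number of ones)] times [r] if the last bit is 1
    ([fin_cylinder_sum]), where [r] is a composition of such maps applied to 1.

    Both maps are nonexpanding for the multiplicative distance on the positive
    reals.  At a valley, that is a down step followed by an up step, the composite
    has image in a bounded interval and contracts by the factor [q / (1 + q)]
    ([valley_le_mul]).  Since [x] is irrational its continued fraction is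
    infinite, so the snake has infinitely many valleys ([cf_snake_valleys]) and the
    compositions converge to a limit [rho k], uniformly in the starting point
    and hence in the continuation of the finite snake ([tail_ratio_limits]).
    This gives the limit ratios [ratio_cvg_weight].

    The limits satisfy [rho k = step (rho k.+1)], which says exactly that the
    normalised weights of the prefixes are consistent as [k] grows.  A measure
    with these marginals is obtained by inverse transform sampling: [0, 1[ is
    cut into nested half-open intervals indexed by prefixes, with the prescribed
    lengths ([cell_size]), and the uniform measure is pushed forward along the
    map sending a point to the word of the intervals that contain it
    ([snake_measure_cylinder]).

    Uniqueness holds because cylinders form a pi-system generating the Borel
    sigma-algebra ([borel_cylinders]) and limit ratios are unique. *)

Set Implicit Arguments.
Unset Strict Implicit.
Unset Printing Implicit Defensive.

Import Order.TTheory GRing.Theory Num.Theory.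
Import numFieldNormedType.Exports.

Local Open Scope classical_set_scope.
Local Open Scope ring_scope.

(** * Filters of a snake as locally constrained words *)

Implicit Types (d f g : nat -> bool) (i j k m n : nat).

(** The explicit form of the order of a snake: comparable vertices are joined by
    a stretch of steps all going the same way. *)
Definition run (d : nat -> bool) (i j : nat) : Prop :=
  ((i <= j)%N /\ forall t, (i <= t < j)%N -> ~~ d t) \/
  ((j <= i)%N /\ forall t, (j <= t < i)%N -> d t).

(** A path of covers cannot turn back, because the same edge would have to be
    both an up step and a down step. *)
Lemma cover_path_run d i p : path (snake_cover d) i p -> run d i (last i p).
Proof.
elim: p i => [|a p IH] i /=; first by left; split=> // t; lia.
case/andP=> ia /IH; move: (last a p) => j {IH}.
case/orP: ia => /andP[/eqP-> da] [] [ij H].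
- have [ja|ja] := eqVneq j a.
    by right; split=> [|t tj]; [lia|have -> : t = a by lia].
  by have := H a; rewrite da => /(_ _)/implyP; lia.
- right; split=> [|t tj]; first lia.
  by have [->//|ta] := eqVneq t a; apply: H; lia.
- left; split=> [|t tj]; first lia.
  by have [->//|ta] := eqVneq t i; apply: H; lia.
- have [ja|ja] := eqVneq j i.+1.
    by left; split=> [|t tj]; [lia|have -> : t = i by lia].
  by have := H i; rewrite (negbTE da) => /(_ _)/implyP; lia.
Qed.

Definition edge_ok (d f : nat -> bool) (i : nat) : bool :=
  if d i then f i.+1 ==> f i else f i ==> f i.+1.

Definition prefix_filter (d : nat -> bool) (k : nat) (f : nat -> bool) : bool :=
  all (edge_ok d f) (iota 0 k).

Lemma prefix_filterP d k f :
  reflect (forall i, (i < k)%N -> edge_ok d f i) (prefix_filter d k f).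
Proof.
apply: (iffP allP) => H i; last by rewrite mem_iota => /andP[_ ik]; exact: H.
by move=> ik; apply: H; rewrite mem_iota.
Qed.

Lemma prefix_filterS d k f :
  prefix_filter d k.+1 f = prefix_filter d k f && edge_ok d f k.
Proof. by rewrite /prefix_filter -addn1 iotaD all_cat /= andbT. Qed.

Lemma prefix_filter_le d k m f : (k <= m)%N ->
  prefix_filter d m f -> prefix_filter d k f.
Proof.
move=> km /prefix_filterP H; apply/prefix_filterP => i ik.
by apply: H; exact: leq_trans km.
Qed.

Lemma eq_prefix_filter d k f g : (forall i, (i <= k)%N -> f i = g i) ->
  prefix_filter d k f = prefix_filter d k g.
Proof.
move=> fg; apply: eq_in_all => i; rewrite mem_iota => /andP[_ ik].
by rewrite /edge_ok !fg // ltnW.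
Qed.

Lemma eq_snake_prefix_filter d d' k f : (forall i, (i < k)%N -> d i = d' i) ->
  prefix_filter d k f = prefix_filter d' k f.
Proof.
move=> dd'; apply: eq_in_all => i; rewrite mem_iota => /andP[_ ik].
by rewrite /edge_ok dd'.
Qed.

(** Monotone runs between two vertices of [0, ..., k] stay inside [0, ..., k];
    therefore the subposet induced on an initial block is the snake on that
    block, and the local condition up to [k] suffices. *)
Lemma prefix_filter_run d k f i j : prefix_filter d k f ->
  (i <= k)%N -> (j <= k)%N -> f i -> run d i j -> f j.
Proof.
move=> /prefix_filterP fk ik jk fi [] [ij H].
- elim: j ij jk H => [|j IH] ij jk H; first by have <- : i = 0%N by lia.
  have [<-//|nij] := eqVneq i j.+1.
  have fj : f j by apply: IH => [||t tj]; [lia|lia|apply: H; lia].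
  have := fk j jk; rewrite /edge_ok (negbTE (H j _)) ?fj //; lia.
- elim: i ij ik H fi => [|i IH] ij ik H fi; first by have -> : j = 0%N by lia.
  have [->//|nij] := eqVneq j i.+1.
  apply: IH => [||t ti|]; [lia|lia|by apply: H; lia|].
  have := fk i ik; rewrite /edge_ok (H i _) ?fi //; lia.
Qed.

Lemma snake_le_up d i : ~~ d i -> snake_le d i i.+1.
Proof. by move=> di; exists [:: i.+1] => //=; rewrite /snake_cover di eqxx orbT. Qed.

Lemma snake_le_down d i : d i -> snake_le d i.+1 i.
Proof. by move=> di; exists [:: i] => //=; rewrite /snake_cover di eqxx. Qed.

Lemma snake_le_run d i j : snake_le d i j -> run d i j.
Proof. by case=> p /cover_path_run + ->. Qed.

Lemma snake_filterP d f :
  snake_filter d f <-> forall k, prefix_filter d k f.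
Proof.
split=> [H k|H i j fi /snake_le_run ij]; last first.
  by apply: (prefix_filter_run (H (maxn i j))) ij; rewrite ?leq_maxl ?leq_maxr.
apply/prefix_filterP => i _; rewrite /edge_ok; case: ifPn => di; apply/implyP.
  by move=> fi; apply: H fi (snake_le_down di).
by move=> fi; apply: H fi (snake_le_up di).
Qed.

Lemma atomE d k f : atom d (snake_trace k f) = prefix_filter d k f.
Proof.
apply/asboolP/idP => [H|fk i j]; last first.
  rewrite !inE => fi /snake_le_run; apply: (prefix_filter_run fk) => //.
    by rewrite -ltnS.
  by rewrite -ltnS.
apply/prefix_filterP => i ik; rewrite /edge_ok.
have i1 : (i < k.+1)%N by lia.
have i2 : (i.+1 < k.+1)%N by lia.
case: ifPn => di; apply/implyP => fi.
  have := H (Ordinal i2) (Ordinal i1); rewrite !inE /= => -> //.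
  exact: snake_le_down.
have := H (Ordinal i1) (Ordinal i2); rewrite !inE /= => -> //.
exact: snake_le_up.
Qed.

(** [inord] makes [bits F] meaningless beyond [m]; only its values on
    [0, ..., m] are used. *)
Definition bits (m : nat) (F : {set 'I_m.+1}) : nat -> bool :=
  fun i => inord i \in F.

Lemma snake_trace_bits m (F : {set 'I_m.+1}) : snake_trace m (bits F) = F.
Proof. by apply/setP => i; rewrite inE /bits inord_val. Qed.

Lemma bits_snake_trace m f i : (i <= m)%N -> bits (snake_trace m f) i = f i.
Proof. by move=> im; rewrite /bits inE inordK. Qed.

Lemma snake_traceP k f g :
  reflect (forall i, (i <= k)%N -> f i = g i)
          (snake_trace k f == snake_trace k g).
Proof.
apply: (iffP eqP) => [fg i ik|fg].
  by rewrite -(bits_snake_trace f ik) fg bits_snake_trace.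
by apply/setP => i; rewrite !inE fg // -ltnS.
Qed.

Lemma atom_bits d k (A : {set 'I_k.+1}) : atom d A = prefix_filter d k (bits A).
Proof. by rewrite -atomE snake_trace_bits. Qed.

Lemma fin_snake_filterE d m (F : {set 'I_m.+1}) :
  fin_snake_filter d F = prefix_filter d m (bits F).
Proof.
apply/forallP/idP => [H|Fm i]; last first.
  apply/forallP => j; apply/implyP => /andP[Fi /connectP[p ip ej]].
  have {ip}: path (snake_cover d) i (map val p).
    by rewrite path_map; apply: sub_path ip => a b.
  move/cover_path_run; rewrite last_map -ej => ij.
  have := @prefix_filter_run _ _ _ i j Fm.
  by rewrite /bits !inord_val; apply => //; rewrite -ltnS.
apply/prefix_filterP => i im; rewrite /edge_ok /bits.
have i1 : (inord i : 'I_m.+1) = i :> nat by rewrite inordK //; lia.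
have i2 : (inord i.+1 : 'I_m.+1) = i.+1 :> nat by rewrite inordK //; lia.
by case: ifPn => di; apply/implyP => Fi;
  [have /forallP/(_ (inord i)) := H (inord i.+1)
  |have /forallP/(_ (inord i.+1)) := H (inord i)];
  rewrite Fi /= => /implyP; apply; apply: connect1;
  rewrite /snake_cover i1 i2 eqxx di ?orbT.
Qed.

(** * Transfer recursion for finite snakes *)

Section weights.
Variables (R : realType) (q : R).
Implicit Types (r s : R) (b : bool).

(** Effect of one more edge on the quotient of the two continuation sums (last
    bit 1 over last bit 0): an edge going down ([b = true]) forces 0 after 0, an
    edge going up forces 1 after 1. *)
Definition step b r : R := if b then 1 + q * r else q * r / (1 + q * r).

Fixpoint tail_ratio d k n r : R :=
  if n is n'.+1 then step (d k) (tail_ratio d k.+1 n' r) else r.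

Definition weight r k f : R :=
  q ^+ (\sum_(i < k.+1) f i) * (if f k then r else 1).

Lemma tail_ratioD d k m n r :
  tail_ratio d k (m + n) r = tail_ratio d k m (tail_ratio d (k + m) n r).
Proof.
by elim: m k => [|m IH] k /=; rewrite ?addn0 // IH addSnnS.
Qed.

Lemma eq_tail_ratio d d' k n r : (forall i, (k <= i < k + n)%N -> d i = d' i) ->
  tail_ratio d k n r = tail_ratio d' k n r.
Proof.
elim: n k => //= n IH k dd'; rewrite dd' ?IH => [//|i ki|]; last lia.
by apply: dd'; lia.
Qed.

Definition upd f k b : nat -> bool := fun i => if i == k then b else f i.

Lemma updE f k b : upd f k b k = b.
Proof. by rewrite /upd eqxx. Qed.

Lemma upd_lt f k b i : (i < k)%N -> upd f k b i = f i.
Proof. by move=> ik; rewrite /upd ltn_eqF. Qed.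

Lemma weight_upd r k f b : weight r k.+1 (upd f k.+1 b) =
  q ^+ (\sum_(i < k.+1) f i) * (if b then q * r else 1).
Proof.
rewrite /weight big_ord_recr /= updE exprD -mulrA; congr (q ^+ _ * _).
  by apply: eq_bigr => i _; rewrite upd_lt.
by case: b; rewrite ?expr1 // expr0 mul1r.
Qed.

Lemma edge_ok_upd d f k b : edge_ok d (upd f k.+1 b) k =
  if d k then b ==> f k else f k ==> b.
Proof. by rewrite /edge_ok updE upd_lt. Qed.

(** The factor by which the total weight of the one-vertex extensions exceeds
    the weight of a prefix.  It depends on the edge but not on the last bit of
    the prefix, which is why the ratios of weights survive the summation. *)
Definition step_norm b r : R := if b then 1 else 1 + q * r.

Lemma snake_trace_upd k f g b :
  (snake_trace k g == snake_trace k f) && (g k.+1 == b) =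
  (snake_trace k.+1 g == snake_trace k.+1 (upd f k.+1 b)).
Proof.
apply/andP/snake_traceP => [[/snake_traceP gf /eqP gb] i|gf].
  by rewrite leq_eqVlt => /predU1P[->|ik]; rewrite ?updE // upd_lt // gf.
split; last by rewrite gf // updE.
by apply/snake_traceP => i ik; rewrite gf ?upd_lt // leqW.
Qed.

Lemma fin_cylinderE d m k f (F : {set 'I_m.+1}) :
  fin_snake_filter d F && fin_cylinder (snake_trace k f) F =
  prefix_filter d m (bits F) && (snake_trace k (bits F) == snake_trace k f).
Proof. by rewrite fin_snake_filterE. Qed.

Lemma card_snake_trace k f : #|snake_trace k f| = (\sum_(i < k.+1) f i)%N.
Proof.
rewrite -sum1_card big_mkcond /=; apply: eq_bigr => i _.
by rewrite inE; case: (f i).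
Qed.

Hypothesis q0 : 0 < q.

Lemma step_gt0 b r : 0 < r -> 0 < step b r.
Proof.
move=> r0; rewrite /step; have qr : 0 < q * r by exact: mulr_gt0.
by case: b; rewrite ?divr_gt0 // addr_gt0.
Qed.

Lemma tail_ratio_gt0 d k n r : 0 < r -> 0 < tail_ratio d k n r.
Proof. by move=> r0; elim: n k => //= n IH k; exact: step_gt0. Qed.

Lemma weight_gt0 r k f : 0 < r -> 0 < weight r k f.
Proof. by move=> r0; rewrite mulr_gt0 ?exprn_gt0 //; case: ifP. Qed.

Lemma step_norm_gt0 b r : 0 < r -> 0 < step_norm b r.
Proof. by move=> r0; case: b; rewrite /= ?addr_gt0 ?mulr_gt0. Qed.

(** The transfer-matrix recursion: [step] is chosen precisely so that summing
    the next bit out turns weights with parameter [r] into multiples of weights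
    with parameter [step r]. *)
Lemma weight_extensions d r k f : 0 < r ->
  \sum_b (if edge_ok d (upd f k.+1 b) k then weight r k.+1 (upd f k.+1 b) else 0) =
  step_norm (d k) r * weight (step (d k) r) k f.
Proof.
move=> r0; rewrite big_bool /= !edge_ok_upd !weight_upd /weight /step /step_norm.
have : 1 + q * r != 0 by rewrite lt0r_neq0 // addr_gt0 // mulr_gt0.
by case: (d k); case: (f k) => //= nz; rewrite ?addr0 ?add0r; field.
Qed.

(** The constant [C] is the same for all prefixes, so it cancels in ratios of
    cylinder probabilities.  The starting value 1 expresses that a finite snake
    has no vertex after [m]. *)
Lemma fin_cylinder_sum d m k n : (k + n)%N = m ->
  exists2 C : R, 0 < C & forall f, prefix_filter d k f ->
    \sum_(F : {set 'I_m.+1} | fin_snake_filter d F &&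
        fin_cylinder (snake_trace k f) F) q ^+ #|F| =
    C * weight (tail_ratio d k n 1) k f.
Proof.
elim: n k => [|n IH] k kn.
  (* No vertex is left to sum over: the cylinder is one filter. *)
  rewrite addn0 in kn; subst k; exists 1 => // f fm.
  rewrite (big_pred1 (snake_trace m f)) => [|F]; last first.
    rewrite fin_cylinderE /= -[F in RHS]snake_trace_bits.
    case: (snake_trace m (bits F) =P snake_trace m f) => [E|_]; last first.
      by rewrite andbF.
    by rewrite andbT -(atomE d m) E atomE.
  by rewrite card_snake_trace /weight /=; case: ifP; rewrite !mulr1 mul1r.
have [|C C0 HC] := IH k.+1; first by rewrite addSnnS.
set r := tail_ratio d k.+1 n 1 in HC *.
have r0 : 0 < r by exact: tail_ratio_gt0.
exists (C * step_norm (d k) r) => [|f fk].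
  by rewrite mulr_gt0 // step_norm_gt0.
rewrite -mulrA -/(tail_ratio d k n.+1 1) /= -weight_extensions // big_distrr /=.
rewrite (partition_big (fun F : {set 'I_m.+1} => bits F k.+1) predT) //=.
apply: eq_bigr => b _.
rewrite (eq_bigl (fun F => fin_snake_filter d F &&
    fin_cylinder (snake_trace k.+1 (upd f k.+1 b)) F)) => [|F]; last first.
  by rewrite !fin_cylinderE -andbA snake_trace_upd.
have fk' : prefix_filter d k.+1 (upd f k.+1 b) = edge_ok d (upd f k.+1 b) k.
  rewrite prefix_filterS (@eq_prefix_filter _ _ _ f) ?fk // => i ik.
  by rewrite upd_lt.
case: ifPn => [ok|nok]; first by rewrite HC // fk'.
(* A forbidden next bit contributes no filter at all. *)
rewrite mulr0 big_pred0 // => F; rewrite fin_cylinderE.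
apply/negP => /andP[Fm /eqP tr].
have km : (k.+1 <= m)%N by lia.
by move: (prefix_filter_le km Fm); rewrite -atomE tr atomE fk' (negbTE nok).
Qed.
End weights.

(** * Contraction at valleys *)

Definition has_valleys d : Prop :=
  forall k, exists i, [/\ (k <= i)%N, d i & ~~ d i.+1].

Section contraction.
Variables (R : realType) (q : R).
Hypothesis q0 : 0 < q.
Implicit Types (e r s : R) (b : bool).

(** The maps [step q b] are nonexpanding for the distance [|log r - log s|]; the
    bound [r <= (1 + e) * s] and its mirror image replace logarithms. *)
Lemma step_le_mul b e r s : 0 <= e -> 0 < r -> 0 < s ->
  r <= (1 + e) * s -> step q b r <= (1 + e) * step q b s.
Proof.
move=> e0 r0 s0 rs.
have qrs : q * r <= (1 + e) * (q * s) by rewrite mulrCA ler_pM2l.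
have qr0 : 0 < q * r by exact: mulr_gt0.
have qs0 : 0 < q * s by exact: mulr_gt0.
rewrite /step; case: b; first by nra.
rewrite ler_pdivrMr ?addr_gt0 // mulrA mulrAC ler_pdivlMr ?addr_gt0 //.
have := mulr_gt0 qr0 qs0; move: (q * r) (q * s) qrs qr0 qs0 => u v uv u0 v0 uv0.
have : 0 <= e * (u * v) by rewrite mulr_ge0 // ltW.
nra.
Qed.

(** Strict contraction: after the up step the value is at most 1, and
    [v |-> 1 + q v] has logarithmic derivative [q v / (1 + q v)], which on
    [v <= 1] is at most [q / (1 + q)]. *)
Lemma valley_le_mul e r s : 0 <= e -> 0 < r -> 0 < s -> r <= (1 + e) * s ->
  step q true (step q false r) <=
  (1 + e * (q / (1 + q))) * step q true (step q false s).
Proof.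
move=> e0 r0 s0 rs; have := @step_le_mul false _ _ _ e0 r0 s0 rs.
have : step q false s <= 1.
  by rewrite /step ler_pdivrMr ?addr_gt0 ?mulr_gt0 // mul1r lerDr.
have : 0 < step q false s by exact: step_gt0.
move: (step q false r) (step q false s) => u v v0 v1 uv; rewrite /step.
have q1 : 0 < 1 + q by rewrite addr_gt0.
have -> : (1 + e * (q / (1 + q))) * (1 + q * v) =
   1 + q * v + e * q * (1 + q * v) / (1 + q) by field; rewrite lt0r_neq0.
have : e * q * v <= e * q * (1 + q * v) / (1 + q).
  rewrite ler_pdivlMr // -[leLHS]mulrA.
  apply: ler_wpM2l; first by rewrite mulr_ge0 // ltW.
  by rewrite mulrDr mulr1 mulrC lerD2r.
have : q * u <= q * ((1 + e) * v) by rewrite ler_pM2l.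
by lra.
Qed.

(** A single valley already brings all positive reals into a bounded interval;
    this starts the contraction. *)
Lemma valley_bounds r : 0 < r ->
  1 < step q true (step q false r) < 1 + q.
Proof.
move=> r0; rewrite /step ltrDl ltrD2l.
have qr : 0 < q * r by exact: mulr_gt0.
have qr1 : 0 < 1 + q * r by exact: addr_gt0.
rewrite mulr_gt0 ?divr_gt0 //= -[ltRHS]mulr1 ltr_pM2l // ltr_pdivrMr //.
by rewrite mul1r ltrDr.
Qed.

Lemma tail_ratio_le_mul d k n e r s : 0 <= e -> 0 < r -> 0 < s ->
  r <= (1 + e) * s ->
  tail_ratio q d k n r <= (1 + e) * tail_ratio q d k n s.
Proof.
move=> e0 r0 s0 rs; elim: n k => //= n IH k.
by apply: step_le_mul => //; exact: tail_ratio_gt0.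
Qed.

(** The constant counts [j + 1] valleys: the first one met by the composition (the
    rightmost) gives the ratio [1 + q], each of the others a factor
    [q / (1 + q)] on the excess over 1. *)
Lemma tail_ratio_valleys d j : has_valleys d -> forall k, exists N,
  forall n r s, (N <= n)%N -> 0 < r -> 0 < s ->
  tail_ratio q d k n r <=
  (1 + q * (q / (1 + q)) ^+ j) * tail_ratio q d k n s.
Proof.
move=> pk; have c0 : 0 <= q / (1 + q) by rewrite divr_ge0 ?addr_ge0 ?ltW.
elim: j => [|j IH] k; have [i [ki di di1]] := pk k.
  exists (i - k + 2)%N => n r s Nn r0 s0.
  have -> : n = (i - k + (n - (i - k + 2)).+2)%N by lia.
  set m := (n - _)%N; rewrite !tail_ratioD subnKC //= di (negbTE di1).
  have p t : 0 < t -> 0 < tail_ratio q d i.+2 m t by exact: tail_ratio_gt0.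
  apply: tail_ratio_le_mul; rewrite ?step_gt0 ?p //.
    by rewrite expr0 mulr1 ltW.
  rewrite expr0 mulr1; have /andP[_ /ltW/le_trans] := valley_bounds (p r r0).
  apply; rewrite -[leLHS]mulr1 ler_pM2l ?addr_gt0 //.
  by have /andP[/ltW] := valley_bounds (p s s0).
(* The first valley after [k] contracts once; the other [j] contractions come
   from the tail after it. *)
have [N HN] := IH i.+2.
exists (i - k + N.+2)%N => n r s Nn r0 s0.
have -> : n = (i - k + (n - (i - k + 2)).+2)%N by lia.
set m := (n - _)%N; rewrite !tail_ratioD subnKC //= di (negbTE di1).
have p t : 0 < t -> 0 < tail_ratio q d i.+2 m t by exact: tail_ratio_gt0.
apply: tail_ratio_le_mul; rewrite ?step_gt0 ?p //.
  by rewrite mulr_ge0 ?exprn_ge0 // ltW.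
rewrite exprSr mulrA; apply: valley_le_mul; rewrite ?p //.
  by rewrite mulr_ge0 ?exprn_ge0 // ltW.
by apply: HN => //; rewrite /m; lia.
Qed.

Lemma tail_ratio_near_mul d e : has_valleys d -> 0 < e -> forall k, exists N,
  forall n r s, (N <= n)%N -> 0 < r -> 0 < s ->
  tail_ratio q d k n r <= (1 + e) * tail_ratio q d k n s.
Proof.
move=> pk e0 k; set c := q / (1 + q).
have c0 : 0 <= c by rewrite divr_ge0 ?addr_ge0 ?ltW.
have c1 : `|c| < 1.
  by rewrite ger0_norm // ltr_pdivrMr ?addr_gt0 // mul1r ltrDr.
have /cvgrPdist_lt/(_ (e / q)) := cvg_expr c1.
rewrite divr_gt0 // => /(_ isT)[j _ /(_ j (leqnn j))] /=.
rewrite sub0r normrN ger0_norm ?exprn_ge0 // => ce.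
have [N HN] := tail_ratio_valleys j pk k.
exists N => n r s Nn r0 s0; apply: le_trans (HN _ _ _ Nn r0 s0) _.
rewrite ler_pM2r ?tail_ratio_gt0 // lerD2l mulrC -ler_pdivlMr //.
exact: ltW.
Qed.

(** From relative to absolute closeness, using a bound [B] on all late
    compositions. *)
Lemma tail_ratio_cauchy d : has_valleys d -> forall k e, 0 < e -> exists N,
  forall m n r s, (N <= m)%N -> (N <= n)%N -> 0 < r -> 0 < s ->
  `|tail_ratio q d k m r - tail_ratio q d k n s| < e.
Proof.
move=> pk k.
have [N0 HN0] := tail_ratio_near_mul pk ltr01 k.
pose B := (1 + 1) * tail_ratio q d k N0 1 : R.
have B0 : 0 < B by rewrite mulr_gt0 ?tail_ratio_gt0.
have HB n r : (N0 <= n)%N -> 0 < r -> tail_ratio q d k n r <= B.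
  move=> Nn r0; rewrite -(subnKC Nn) tail_ratioD.
  by apply: HN0 => //; exact: tail_ratio_gt0.
move=> e e0; have [|N HN] := @tail_ratio_near_mul d (e / B / 2) pk _ k.
  by rewrite !divr_gt0.
pose M := maxn N0 N.
have half m n r s : (M <= m)%N -> (M <= n)%N -> 0 < r -> 0 < s ->
    tail_ratio q d k m r - tail_ratio q d k n s <= e / 2.
  rewrite /M => Mm Mn r0 s0; rewrite lerBlDl.
  have Nm : (N <= m)%N by lia.
  have Nn : (N <= n)%N by lia.
  have sB : tail_ratio q d k n s <= B by apply: HB => //; lia.
  rewrite -(subnKC Nm) -(subnKC Nn) !tail_ratioD in sB *.
  set u := tail_ratio q d (k + N) _ r; set v := tail_ratio q d (k + N) _ s in sB *.
  have u0 : 0 < u by exact: tail_ratio_gt0.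
  have v0 : 0 < v by exact: tail_ratio_gt0.
  apply: le_trans (HN N u v (leqnn N) u0 v0) _.
  rewrite mulrDl mul1r lerD2l mulrAC ler_pM2r ?invr_gt0 //.
  by rewrite mulrAC ler_pdivrMr // ler_pM2l.
exists M => m n r s Mm Mn r0 s0.
apply: (@le_lt_trans _ _ (e / 2)); last by lra.
by rewrite ler_norml half // andbT lerNl opprB half.
Qed.
End contraction.

(** * Limits of the tail ratios *)

Section limits.
Variables (R : realType) (q : R).
Hypothesis q0 : 0 < q.

Lemma step_lipschitz b (r s : R) : 0 <= r -> 0 <= s ->
  `|step q b r - step q b s| <= q * `|r - s|.
Proof.
move=> r0 s0; rewrite /step; case: b.
  by rewrite opprD addrACA subrr add0r -mulrBr normrM gtr0_norm.
have qr : 0 <= q * r by rewrite mulr_ge0 // ltW.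
have qs : 0 <= q * s by rewrite mulr_ge0 // ltW.
have qr1 : 0 < 1 + q * r by rewrite ltr_wpDr.
have qs1 : 0 < 1 + q * s by rewrite ltr_wpDr.
have -> : q * r / (1 + q * r) - q * s / (1 + q * s) =
    q * (r - s) / ((1 + q * r) * (1 + q * s)).
  by field; rewrite !lt0r_neq0.
rewrite normrM normfV normrM gtr0_norm // [X in _ / X]gtr0_norm ?mulr_gt0 //.
rewrite ler_pdivrMr ?mulr_gt0 //; apply: ler_peMr; last nra.
by rewrite mulr_ge0 // ltW.
Qed.

(** The recursion for [rho] follows by continuity of [step].  Positivity is not
    preserved by limits; it comes from the next down step, where [rho >= 1], and
    goes backwards along the recursion. *)
Lemma tail_ratio_limits d : has_valleys d -> exists2 rho : nat -> R,
  (forall k, 0 < rho k /\ rho k = step q (d k) (rho k.+1)) &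
  forall k (e : R), 0 < e -> exists N, forall n r, (N <= n)%N -> 0 < r ->
    `|tail_ratio q d k n r - rho k| < e.
Proof.
move=> pk; pose u k n := tail_ratio q d k n 1.
have u_cvg k : cvg (u k n @[n --> \oo]).
  apply/cauchy_cvgP/cauchy_exP => e e0.
  have [N HN] := tail_ratio_cauchy q0 pk k e0.
  by exists (u k N); exists N => // n Nn; apply: HN.
pose rho k := lim (u k n @[n --> \oo]).
have lim_rho k e : 0 < e -> exists N, forall n r, (N <= n)%N -> 0 < r ->
    `|tail_ratio q d k n r - rho k| < e.
  move=> e0; have e20 : 0 < e / 2 by lra.
  have [N HN] := tail_ratio_cauchy q0 pk k e20.
  have /cvgrPdist_lt/(_ _ e20)[M _ HM] := u_cvg k.
  exists N => n r Nn r0.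
  have := HN n (maxn M N) r 1 Nn (leq_maxr _ _) r0 ltr01.
  have := HM (maxn M N) (leq_maxl _ _) => /=; rewrite -/(rho k) -/(u k _).
  rewrite distrC => H1 H2; apply: le_lt_trans (ler_distD (u k (maxn M N)) _ _) _.
  by rewrite [e]splitr ltrD.
have rho_ge0 k : 0 <= rho k.
  rewrite leNgt; apply/negP; rewrite -oppr_gt0.
  move=> /(lim_rho k)[N /(_ N 1 (leqnn N) ltr01)].
  have : 0 < tail_ratio q d k N 1 by exact: tail_ratio_gt0.
  by rewrite ltr_norml => H0 /andP[H1 H2]; lra.
have rho_step k : rho k = step q (d k) (rho k.+1).
  apply/eqP; rewrite -subr_eq0 -normr_eq0 eq_le normr_ge0 andbT.
  apply/ler_addgt0Pl => e e0; rewrite addr0.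
  have [|N HN] := lim_rho k (e / 2); first by lra.
  have [|M HM] := lim_rho k.+1 (e / 2 / q); first by rewrite divr_gt0 //; lra.
  have {HN}HN := HN (maxn M N).+1 1 (leqW (leq_maxr _ _)) ltr01.
  have {HM}HM := HM (maxn M N) 1 (leq_maxl _ _) ltr01.
  apply: le_trans (ler_distD (tail_ratio q d k (maxn M N).+1 1) _ _) _.
  rewrite distrC [e]splitr lerD ?(ltW HN) //=.
  apply: le_trans (step_lipschitz _ _ _) _ => //.
    by apply: ltW; exact: tail_ratio_gt0.
  by rewrite -ler_pdivlMl // mulrC ltW.
exists rho => // k; split=> //.
have [i [ki di _]] := pk k.
rewrite -(subKn ki); elim: (i - k)%N => [|m IH].
  by rewrite subn0 rho_step di /step ltr_wpDr // mulr_ge0 // ltW.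
have [im|mi] := leqP i m.
  have -> : (i - m.+1 = i - m)%N by lia.
  exact: IH.
by rewrite rho_step; apply: step_gt0; rewrite // -subSn.
Qed.
End limits.

(** * Limit ratios of cylinder probabilities *)

Section ratio_limits.
Variables (R : realType) (q : R).
Hypothesis q0 : 0 < q.

Lemma fin_snake_prob_ratio d m (E E0 : pred {set 'I_m.+1}) :
  fin_snake_prob q d E / fin_snake_prob q d E0 =
  (\sum_(F | fin_snake_filter d F && E F) q ^+ #|F|) /
  (\sum_(F | fin_snake_filter d F && E0 F) q ^+ #|F|).
Proof.
rewrite /fin_snake_prob; set Z := \sum_(F | fin_snake_filter d F) q ^+ #|F|.
have Z0 : Z != 0.
  rewrite lt0r_neq0 // /Z (bigD1 finset.set0) /=; last first.
    by apply/forallP => i; apply/forallP => j; rewrite inE.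
  by rewrite ltr_wpDr ?exprn_gt0 // sumr_ge0 // => F _; rewrite exprn_ge0 // ltW.
by rewrite invfM invrK mulrACA mulVf // mulr1.
Qed.

Lemma weight_ratio_cvg k f g (r : R) : 0 < r ->
  weight q s k f / weight q s k g @[s --> r] --> weight q r k f / weight q r k g.
Proof.
move=> r0.
have W h : weight q s k h @[s --> r] --> weight q r k h.
  by rewrite /weight; case: (h k); [apply: cvgMr; exact: cvg_id|exact: cvg_cst].
by apply: cvgM (W f) (cvgV _ (W g)); rewrite lt0r_neq0 // weight_gt0.
Qed.

(** The finite snake agrees with [d] up to [l], so its tail ratio at [k] is
    [l - k] steps of [d] applied to an unknown positive number; uniformity in
    that number is uniformity in the continuation of the snake. *)
Lemma ratio_cvg_weight d (rho : nat -> R) k (E0 E : {set 'I_k.+1}) :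
  0 < rho k ->
  (forall e : R, 0 < e -> exists N, forall n r, (N <= n)%N -> 0 < r ->
    `|tail_ratio q d k n r - rho k| < e) ->
  atom d E0 -> atom d E ->
  ratio_cvg q d E0 E
    (weight q (rho k) k (bits E) / weight q (rho k) k (bits E0)).
Proof.
move=> rho0 lim_rho aE0 aE eps eps0.
have /cvgrPdist_lt/(_ _ eps0)/nbhs_ballP[e /= e0 He] :=
  @weight_ratio_cvg k (bits E) (bits E0) _ rho0.
have [N HN] := lim_rho e e0; exists (k + N)%N => l Nl kl m d' lm dd'.
have dk (A : {set 'I_k.+1}) : atom d A -> prefix_filter d' k (bits A).
  rewrite atom_bits => H; rewrite -(@eq_snake_prefix_filter d) // => i ik.
  by rewrite dd' //; lia.
have [|C C0 HC] := @fin_cylinder_sum _ _ q0 d' m k (m - k); first by lia.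
rewrite fin_snake_prob_ratio -[X in fin_cylinder X]snake_trace_bits HC ?dk //.
rewrite -[X in fin_cylinder X]snake_trace_bits HC ?dk //.
rewrite -mulf_div divff ?lt0r_neq0 // mul1r distrC; apply: He.
rewrite /ball /= distrC.
have -> : (m - k = (l - k) + (m - l))%N by lia.
rewrite tail_ratioD (@eq_tail_ratio _ _ d' d) => [|i /andP[_ il]].
  by apply: HN; [lia|exact: tail_ratio_gt0].
by rewrite dd' //; lia.
Qed.

(** The snake [d] itself, cut off after [l], is an admissible continuation, so
    the condition defining the limit is never vacuous. *)
Lemma ratio_cvg_unique d k (E0 E : {set 'I_k.+1}) (r s : R) :
  ratio_cvg q d E0 E r -> ratio_cvg q d E0 E s -> r = s.
Proof.
move=> Hr Hs; apply/eqP; rewrite -subr_eq0 -normr_eq0 eq_le normr_ge0 andbT.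
apply/ler_addgt0Pl => e e0; rewrite addr0.
have e20 : 0 < e / 2 by lra.
have [M HM] := Hr _ e20; have [N HN] := Hs _ e20.
pose l := (M + N + k.+1)%N.
have {HM} := HM l ltac:(lia) ltac:(lia) l.+1 d (ltnSn l) (fun _ _ => erefl).
have {HN} := HN l ltac:(lia) ltac:(lia) l.+1 d (ltnSn l) (fun _ _ => erefl).
set x := _ / _ => Hx Hx'; apply/ltW; apply: le_lt_trans (ler_distD x _ _) _.
by rewrite [e]splitr ltrD // distrC.
Qed.
End ratio_limits.

(** * Continued fractions and valleys *)

Section continued_fraction.
Variable R : realType.
Implicit Types x y : R.

Lemma irrational_subV y : irrational y ->
  irrational ((y - (Num.floor y)%:~R)^-1).
Proof.
move=> irr [r _ rE]; apply: irr; exists (r^-1 + (Num.floor y)%:~R) => //.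
by rewrite rmorphD /= fmorphV /= rE invrK ratr_int subrK.
Qed.

Lemma complete_quotient_irrational x n : irrational x ->
  irrational (complete_quotient x n).
Proof. by move=> irr; elim: n => //= n; exact: irrational_subV. Qed.

Lemma cf_gt0 x n : irrational x -> (0 < cf x n.+1)%N.
Proof.
move=> irr; rewrite /cf truncn_gt0 /=.
set y := complete_quotient x n.
have irry : irrational y by exact: complete_quotient_irrational.
have /andP[fy yf] := floor_itv y.
rewrite -[leLHS]invr1 lef_pV2 ?posrE ?ltr01 // ?subr_gt0.
  by rewrite lerBlDl (le_trans (ltW yf)) // intrD.
rewrite lt_neqAle fy andbT; apply/eqP => E; apply: irry.
by exists (Num.floor y)%:~R => //; rewrite ratr_int.
Qed.

(** The first block may be empty, since [cf x 0 = 0] for [x < 1]; hence the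
    condition [0 < m]. *)
Lemma cf_sum_lt x m n : irrational x -> (0 < m)%N -> (m < n)%N ->
  (\sum_(j < m) cf x j < \sum_(j < n) cf x j)%N.
Proof.
move=> irr m0; elim: n => // n IH; rewrite ltnS leq_eqVlt => /predU1P[<-|mn].
  rewrite big_ord_recr /= -[ltnLHS]addn0 ltn_add2l.
  by case: m m0 {IH} => // m _; exact: cf_gt0.
by apply: leq_trans (IH mn) _; rewrite big_ord_recr /= leq_addr.
Qed.

(** The step considered is the first one of block [n.+1]. *)
Lemma cf_snake_block x n : irrational x ->
  cf_snake x (\sum_(j < n.+1) cf x j) = odd n.
Proof.
move=> irr; apply/asboolP/idP => [[m [/negbTE mo /andP[mn nm]]]|on].
  have [mn1|mn1|mE] := ltngtP m n.+1.
  - have: (\sum_(j < m.+1) cf x j <= \sum_(j < n.+1) cf x j)%N.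
      have [->//|nm1] := eqVneq m n.
      by apply/ltnW/cf_sum_lt => //; lia.
    by lia.
  - by have := @cf_sum_lt x n.+1 m irr isT mn1; lia.
  - by move/negbT: mo; rewrite mE /= negbK.
exists n.+1; split; first by rewrite /= negbK.
by rewrite leqnn /= cf_sum_lt.
Qed.

Lemma cf_sum_ge x n : irrational x -> (n <= \sum_(j < n.+1) cf x j)%N.
Proof.
move=> irr; elim: n => // n IH.
by apply: leq_ltn_trans IH _; exact: cf_sum_lt.
Qed.

(** Block starts of both parities occur arbitrarily late; between a down step
    and a later up step the direction changes at a valley. *)
Lemma cf_snake_valleys x : irrational x -> has_valleys (cf_snake x).
Proof.
move=> irr k; set d := cf_snake x.
pose S n := (\sum_(j < n.+1) cf x j)%N.
have dS n : d (S n) = odd n by exact: cf_snake_block.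
pose a := S k.*2.+1; pose b := S k.*2.+2.
have ka : (k <= a)%N.
  by apply: leq_trans (cf_sum_ge _ irr); rewrite -addnn; lia.
have ab : (a < b)%N by exact: cf_sum_lt.
have da : d a by rewrite dS /= odd_double.
have db : ~~ d b by rewrite dS /= odd_double.
have [j aj dj] : exists2 j, (a <= j)%N & ~~ d j by exists b => //; exact: ltnW.
elim: j aj dj => [|j IH] aj dj.
  by move: aj dj; rewrite leqn0 => /eqP <-; rewrite da.
have [E|aj'] := eqVneq a j.+1; first by rewrite -E da in dj.
have [dj'|/IH] := boolP (d j); last by apply; lia.
by exists j; split=> //; lia.
Qed.

End continued_fraction.

(** * Cylinders and the Borel sets of the space of filters *)

Section cylinders.

Lemma prefix_near (F : cantor_space) n :
  \forall G \near F, forall i, (i < n)%N -> G i = F i.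
Proof.
elim: n => [|n IH]; first by near=> G => i; rewrite ltn0.
have Fn : \forall G \near F, G n = F n.
  exists (proj n @^-1` [set F n]); split=> //.
  suff : @open cantor_space (proj n @^-1` [set F n]) by [].
  by apply: open_comp; [move=> + _; exact: proj_continuous|exact: discrete_open].
near=> G => i; rewrite ltnS leq_eqVlt => /predU1P[->|].
  by near: G.
by move: i; near: G.
Unshelve. all: by end_near. Qed.

(** Otherwise there would be words outside [V] agreeing with [F] on longer and
    longer prefixes, and these converge to [F] pointwise. *)
Lemma nbhs_prefix (V : set cantor_space) (F : cantor_space) : nbhs F V ->
  exists n, forall G : cantor_space, (forall i, (i < n)%N -> G i = F i) -> V G.
Proof.
move=> FV; apply: contrapT => /forallNP H.
have /choice[G GP] n : exists G : cantor_space,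
    (forall i, (i < n)%N -> G i = F i) /\ ~ V G.
  by have /existsNP[G /not_implyP] := H n; exists G.
have : (G : nat -> cantor_space) n @[n --> \oo] --> F.
  apply/pointwise_cvgP => i; apply: cvg_near_cst.
  by exists i.+1 => // n /= ni; apply: (GP n).1.
by move=> /(_ _ FV)[N _ /(_ N (leqnn N))]; apply: (GP N).2.
Qed.

Variable d : nat -> bool.

Lemma atom_trace k (F : filter_space d) : atom d (snake_trace k (set_val F)).
Proof.
by rewrite atomE; have /set_mem/snake_filterP := valP F; apply.
Qed.

Lemma cylinder_nonatom k (A : {set 'I_k.+1}) : ~~ atom d A ->
  cylinder d A = set0.
Proof.
by move=> /negP nA; rewrite -subset0 => F /= FA; apply: nA; rewrite -FA atom_trace.
Qed.

Lemma cylinder_open k (A : {set 'I_k.+1}) : open (cylinder d A).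
Proof.
exists [set F : cantor_space | snake_trace k F = A] => //.
rewrite openE => F /= FA; apply: filterS (prefix_near F k.+1) => G GF /=.
by rewrite -FA; apply/eqP/snake_traceP => i ik; exact: GF.
Qed.

Lemma open_cylinder (U : set (filter_space d)) F : open U -> U F ->
  exists k, cylinder d (snake_trace k (set_val F)) `<=` U.
Proof.
move=> [V oV <-] /= VF.
have [|n Hn] := @nbhs_prefix V (set_val F); first exact: open_nbhs_nbhs.
exists n => G /= /eqP/snake_traceP GF; apply: Hn => i ni.
by apply: GF; exact: ltnW.
Qed.

(** The empty set is added to make the system closed under intersection. *)
Definition cylinders : set (set (filter_space d)) :=
  [set C | C = set0 \/ exists k (A : {set 'I_k.+1}), C = cylinder d A].

(** Prefixes form a tree, so two cylinders are disjoint or nested. *)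
Lemma setI_cylinder k l (A : {set 'I_k.+1}) (B : {set 'I_l.+1}) : (k <= l)%N ->
  cylinder d A `&` cylinder d B = set0 \/
  cylinder d A `&` cylinder d B = cylinder d B.
Proof.
move=> kl.
have [->|/set0P[F [FA FB]]] := eqVneq (cylinder d A `&` cylinder d B) set0.
  by left.
right; apply: setIidr => G; rewrite /cylinder /= -FA -FB.
move=> /eqP/snake_traceP GF; apply/eqP/snake_traceP => i ik.
by apply: GF; exact: leq_trans kl.
Qed.

Lemma cylinders_setI : setI_closed cylinders.
Proof.
move=> X Y [->|[k [A ->]]]; first by rewrite set0I; left.
move=> [->|[l [B ->]]]; first by rewrite setI0; left.
have [kl|/ltnW lk] := leqP k l.
  by have [->|->] := setI_cylinder A B kl; [left|right; exists l, B].
by rewrite setIC; have [->|->] := setI_cylinder B A lk; [left|right; exists k, A].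
Qed.

Lemma measurable_cylinder k (A : {set 'I_k.+1}) :
  measurable (cylinder d A : set (borel_filter_space d)).
Proof. by apply: sub_sigma_algebra; exact: cylinder_open. Qed.

(** There are countably many prefixes, so an open set is the countable union of
    the cylinders that it contains. *)
Lemma borel_cylinders : @measurable _ (borel_filter_space d) = <<s cylinders >>.
Proof.
apply/seteqP; split; apply: smallest_sub; try exact: smallest_sigma_algebra.
- move=> U oU; pose T := {k : nat & {set 'I_k.+1}}.
  pose C (p : T) := let A := cylinder d (tagged p) in
    if `[< A `<=` U >] then A else set0.
  have -> : U = \bigcup_p C p.
    apply/seteqP; split=> [F UF|F [p _]]; last first.
      by rewrite /C; case: asboolP => // /(_ F).
    have [k kU] := open_cylinder oU UF.
    by exists (existT _ k (snake_trace k (set_val F))) => //; rewrite /C asboolT.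
  apply: (@countable_bigcupT_measurable _ (g_sigma_algebraType cylinders)) => [|p].
    exact: countableP.
  apply: sub_sigma_algebra; rewrite /C; case: asboolP => _; [right|by left].
  by exists (tag p), (tagged p).
- by move=> _ [->|[k [A ->]]]; [exact: measurable0|exact: measurable_cylinder].
Qed.

Lemma eq_probability_cylinders (R : realType)
    (mu nu : probability (borel_filter_space d) R) :
  (forall k (A : {set 'I_k.+1}), atom d A ->
    mu (cylinder d A) = nu (cylinder d A)) ->
  forall A : set (borel_filter_space d), measurable A -> mu A = nu A.
Proof.
move=> mn A mA.
(* [measure_unique] asks for a sequence of generators covering the space: the
   two cylinders on the vertex 0, repeated. *)
pose g i : set (borel_filter_space d) := cylinder d (snake_trace 0 (fun=> odd i)).
apply: (@measure_unique _ R (borel_filter_space d) cylinders g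
  _ _ _ _ mu nu _ _ A mA) => //.
- exact: borel_cylinders.
- exact: cylinders_setI.
- by move=> i; right; exists 0%N; exists (snake_trace 0 (fun=> odd i)).
- apply/seteqP; split=> // F _; exists (set_val F 0%N : nat) => //=.
  by apply/eqP/snake_traceP => i; rewrite leqn0 => /eqP ->; rewrite oddb.
- move=> _ [->|[k [B ->]]]; first by rewrite !measure0.
  have [aB|/cylinder_nonatom ->] := boolP (atom d B); first exact: mn.
  by rewrite !measure0.
- move=> i; apply: le_lt_trans (ltry 1); apply: probability_le1.
  exact: measurable_cylinder.
Qed.

End cylinders.

(** * The uniform measure *)

Section uniform_measure.
Variable R : realType.

Let unit_itv : set (measurableTypeR R) := `[0, 1[%classic.

Let measurable_unit_itv : measurable unit_itv.
Proof. exact: measurable_itv. Qed.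

(** The right end is excluded to match the half-open intervals used for
    sampling. *)
Definition unif01 : set (measurableTypeR R) -> \bar R :=
  mrestr (@lebesgue_measure R) measurable_unit_itv.

HB.instance Definition _ := Measure.on unif01.

Let unif01_setT : unif01 setT = 1%E.
Proof.
by rewrite /unif01 /mrestr setTI lebesgue_measure_itv /= lte_fin ltr01 oppr0 adde0.
Qed.

HB.instance Definition _ :=
  @Measure_isProbability.Build _ _ R unif01 unif01_setT.

Lemma unif01_itv (A : set (measurableTypeR R)) (a b : R) :
  0 <= a -> a <= b -> b <= 1 ->
  (forall u : R, 0 <= u < 1 -> A u <-> a <= u < b) -> unif01 A = (b - a)%:E.
Proof.
move=> a0 ab b1 HA; rewrite /unif01 /mrestr.
have -> : A `&` unit_itv = `[a, b[%classic.
  apply/seteqP; split=> u /=; rewrite !in_itv /=; first by case=> + u01; apply HA.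
  move=> /andP[au ub]; have u01 : 0 <= u < 1.
    by rewrite (le_trans a0 au) (lt_le_trans ub b1).
  by split=> //; apply/(HA _ u01); rewrite au ub.
rewrite lebesgue_measure_itv /= lte_fin.
case: ltP => // ba; have -> : a = b by apply/eqP; rewrite eq_le ab.
by rewrite subrr.
Qed.

End uniform_measure.

(** * Inverse transform sampling of filters *)

Section sampling.
Variables (R : realType) (q : R) (d : nat -> bool) (r : nat -> R).
Hypothesis q0 : 0 < q.
Hypothesis r0 : forall k, 0 < r k.
Hypothesis rS : forall k, r k = step q (d k) (r k.+1).
Implicit Types (u t : R) (b : bool) (c : R * R).

(** The transition probability to bit 1 at vertex [k] whenever the previous
    vertex leaves the choice open; also the initial probability for [k = 0]. *)
Definition theta k : R := q * r k / (1 + q * r k).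

Definition cut t c : R := c.1 + t * (c.2 - c.1).

Definition split_cell t b c : R * R :=
  if b then (c.1, cut t c) else (cut t c, c.2).

(** The interval of the numbers in [0, 1[ that are sampled to the prefix of [f]
    up to [k].  A vertex is free when [d k == f k] for its left neighbour [k]: a
    1 followed by a down step, or a 0 followed by an up step.  Otherwise its bit
    is forced and the interval is not cut. *)
Fixpoint cell f k : R * R :=
  if k is k'.+1 then
    if d k' == f k' then split_cell (theta k) (f k) (cell f k') else cell f k'
  else split_cell (theta 0) (f 0) (0, 1).

(** The current interval is carried along because the next threshold is a point
    of it. *)
Fixpoint sample_state u k : bool * (R * R) :=
  if k is k'.+1 then
    let: (b, c) := sample_state u k' in
    if d k' == b then
      let b' := u < cut (theta k) c in (b', split_cell (theta k) b' c)
    else (b, c)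
  else let b := u < cut (theta 0) (0, 1) in (b, split_cell (theta 0) b (0, 1)).

Definition sample u k : bool := (sample_state u k).1.

Lemma sample_stateE u k : sample_state u k = (sample u k, cell (sample u) k).
Proof.
elim: k => // k IH; have sS : sample u k.+1 =
    if d k == sample u k then u < cut (theta k.+1) (cell (sample u) k)
    else sample u k by rewrite {1}/sample /= IH; case: ifP.
by rewrite /= IH sS; case: ifP.
Qed.

Lemma eq_cell f g k : (forall i, (i <= k)%N -> f i = g i) -> cell f k = cell g k.
Proof.
elim: k => /= [|k IH] fg; first by rewrite fg.
by rewrite !fg // IH // => i ik; apply: fg; exact: leqW.
Qed.

Lemma sampleS u k : sample u k.+1 =
  if d k == sample u k then u < cut (theta k.+1) (cell (sample u) k)
  else sample u k.
Proof. by rewrite {1}/sample /= sample_stateE; case: ifP. Qed.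

(** Forced bits are copied, so every real number, even outside [0, 1[, is
    sampled to a filter. *)
Lemma sample_filter u k : prefix_filter d k (sample u).
Proof.
elim: k => // k IH; rewrite prefix_filterS IH /= /edge_ok sampleS.
by case: (d k); case: (sample u k); rewrite //= implybT.
Qed.

Definition agree f k : set R := [set u | forall i, (i <= k)%N -> sample u i = f i].

Lemma agree0 f : agree f 0 = [set u | (u < cut (theta 0) (0, 1)) = f 0%N].
Proof.
apply/seteqP; split=> u /=; first by move/(_ 0%N (leqnn 0)).
by move=> H i; rewrite leqn0 => /eqP ->.
Qed.

(** Once the prefix up to [k] is known to be [f], the next threshold depends on
    [f] only. *)
Lemma agreeS f k : prefix_filter d k.+1 f -> agree f k.+1 =
  agree f k `&` (if d k == f k
    then [set u | (u < cut (theta k.+1) (cell f k)) = f k.+1] else setT).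
Proof.
rewrite prefix_filterS => /andP[_]; rewrite /edge_ok => fk.
apply/seteqP; split=> u.
  move=> uf; have uf' : agree f k u by move=> i ik; exact/uf/leqW.
  split=> //; case: ifPn => //= dk.
  by rewrite -uf // sampleS uf' // dk (eq_cell uf').
move=> [uf] H i; rewrite leq_eqVlt => /predU1P[->|]; last exact: uf.
rewrite sampleS (eq_cell uf) uf //; move: H fk; case: (d k); case: (f k) => //=.
by case: (f k.+1).
Qed.

Lemma theta_itv k : 0 < theta k < 1.
Proof.
have qr : 0 < q * r k by rewrite mulr_gt0.
by rewrite divr_gt0 ?addr_gt0 //= ltr_pdivrMr ?addr_gt0 // mul1r ltrDr.
Qed.

Lemma split_cell_bounds t b c : 0 < t < 1 -> 0 <= c.1 -> c.1 <= c.2 -> c.2 <= 1 ->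
  let c' := split_cell t b c in [/\ 0 <= c'.1, c'.1 <= c'.2 & c'.2 <= 1].
Proof.
move=> /andP[t0 t1] c0 c12 c1; rewrite /split_cell /cut.
by case: b; split=> /=; nra.
Qed.

Lemma cell_bounds f k :
  [/\ 0 <= (cell f k).1, (cell f k).1 <= (cell f k).2 & (cell f k).2 <= 1].
Proof.
elim: k => [|k [c0 c12 c1]] /=.
  by apply: split_cell_bounds; rewrite ?theta_itv ?ler01.
by case: ifP => // _; apply: split_cell_bounds; rewrite ?theta_itv.
Qed.

Lemma split_cellP t b c u : 0 < t < 1 -> c.1 <= c.2 ->
  (c.1 <= u < c.2 /\ (u < cut t c) = b) <->
  (split_cell t b c).1 <= u < (split_cell t b c).2.
Proof.
move=> /andP[t0 t1] c12; have c1 : c.1 <= cut t c by rewrite /cut; nra.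
have c2 : cut t c <= c.2 by rewrite /cut; nra.
rewrite /split_cell; case: b => /=; split.
- by case=> /andP[-> _] ->.
- by move=> /andP[-> uc]; rewrite uc (lt_le_trans uc c2).
- by case=> /andP[_ ->] /negbT; rewrite -leNgt => ->.
- by move=> /andP[cu ->]; rewrite (le_trans c1 cu) ltNge cu.
Qed.

Lemma agree_cell f k u : prefix_filter d k f -> 0 <= u < 1 ->
  agree f k u <-> (cell f k).1 <= u < (cell f k).2.
Proof.
move=> + u01; elim: k => [_|k IH fk].
  have := @split_cellP (theta 0) (f 0) (0, 1) u (theta_itv 0) ler01.
  by rewrite agree0 /= u01 => <-; split=> [|[]].
have [_ c12 _] := cell_bounds f k.
rewrite agreeS // [cell f k.+1]/=; have {IH} := IH (prefix_filter_le (leqnSn k) fk).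
case: ifP => _ IH; last by rewrite setIT.
rewrite -split_cellP ?theta_itv //.
by split=> -[/IH].
Qed.

Lemma measurable_agree f k : prefix_filter d k f ->
  measurable (agree f k : set (measurableTypeR R)).
Proof.
have mlt (x : R) b : measurable ([set u | (u < x) = b] : set (measurableTypeR R)).
  case: b.
    have -> : [set u | (u < x) = true] = `]-oo, x[%classic.
      by apply/seteqP; split=> u /=; rewrite in_itv.
    exact: measurable_itv.
  have -> : [set u | (u < x) = false] = `[x, +oo[%classic.
    by apply/seteqP; split=> u /=; rewrite in_itv /= andbT leNgt;
      [move=> ->|move/negbTE].
  exact: measurable_itv.
elim: k => [_|k IH fk]; first by rewrite agree0.
rewrite agreeS //; apply: measurableI.
  by apply: IH; apply: prefix_filter_le fk.
by case: ifP.
Qed.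

(** The total weight of the prefixes on [0, ..., k]. *)
Definition mass k : R :=
  (1 + q * r 0) * \prod_(i < k) step_norm q (d i) (r i.+1).

Lemma mass_gt0 k : 0 < mass k.
Proof.
rewrite mulr_gt0 ?addr_gt0 ?mulr_gt0 // prodr_gt0 // => i _.
exact: step_norm_gt0.
Qed.

Lemma split_cell_size t b c : (split_cell t b c).2 - (split_cell t b c).1 =
  (if b then t else 1 - t) * (c.2 - c.1).
Proof. by rewrite /split_cell /cut; case: b => /=; ring. Qed.

(** Here the fixed-point equation [r k = step (r k.+1)] enters: it makes the
    products of transition probabilities equal to the normalised weights. *)
Lemma cell_size f k : prefix_filter d k f ->
  (cell f k).2 - (cell f k).1 = weight q (r k) k f / mass k.
Proof.
have nz k' : 1 + q * r k' != 0 by rewrite lt0r_neq0 // addr_gt0 // mulr_gt0.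
elim: k => [_|k IH].
  rewrite /cell split_cell_size /= /mass big_ord0 /weight big_ord_recr big_ord0.
  rewrite /theta; case: (f 0%N) => /=; rewrite ?expr0 ?expr1; field; exact: nz.
rewrite prefix_filterS => /andP[fk ok].
have mk0 : mass k != 0 by rewrite lt0r_neq0 // mass_gt0.
have mS : mass k.+1 = mass k * step_norm q (d k) (r k.+1).
  by rewrite /mass big_ord_recr /= mulrA.
have wE : weight q (r k.+1) k.+1 f = q ^+ (\sum_(i < k.+1) f i) *
    (if f k.+1 then q * r k.+1 else 1).
  rewrite /weight big_ord_recr /= exprD -mulrA; congr (_ * _).
  by case: (f k.+1); rewrite ?expr0 ?expr1 ?mul1r.
have -> : (cell f k.+1).2 - (cell f k.+1).1 =
    (if d k == f k then if f k.+1 then theta k.+1 else 1 - theta k.+1 else 1) *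
    (weight q (r k) k f / mass k).
  by rewrite -IH // ![cell f k.+1]/=; case: ifP; rewrite ?split_cell_size ?mul1r.
rewrite mS wE /weight rS /step /step_norm /theta; have nzk := nz k.+1.
by move: ok; rewrite /edge_ok; case: (d k); case: (f k); case: (f k.+1) => //= _;
  field; rewrite ?nzk ?mk0.
Qed.

Lemma sample_snake_filter u : sample u \in snake_filter d.
Proof. by apply/mem_set/snake_filterP => k; exact: sample_filter. Qed.

Definition sampler (u : measurableTypeR R) : borel_filter_space d :=
  SigSub (sample_snake_filter u).

Lemma sampler_cylinder k (A : {set 'I_k.+1}) :
  sampler @^-1` cylinder d A = agree (bits A) k.
Proof.
apply/seteqP; split=> u.
  by move=> /= uA i ik; rewrite -uA bits_snake_trace.
move=> uA; apply/eqP; rewrite -[X in _ == X]snake_trace_bits.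
exact/snake_traceP.
Qed.

Lemma measurable_sampler : measurable_fun setT sampler.
Proof.
apply: (@measurability _ _ (measurableTypeR R) (borel_filter_space d) setT
  sampler (@cylinders d)); first exact: borel_cylinders.
move=> _ [_ [->|[k [A ->]]] <-]; rewrite setTI.
  by rewrite preimage_set0; exact: measurable0.
have [aA|/cylinder_nonatom ->] := boolP (atom d A).
  by rewrite sampler_cylinder; apply: measurable_agree; rewrite -atom_bits.
by rewrite preimage_set0; exact: measurable0.
Qed.

HB.instance Definition _ := isMeasurableFun.Build _ _ _ _ sampler measurable_sampler.

Definition snake_measure : probability (borel_filter_space d) R :=
  distribution (@unif01 R) sampler.

Lemma snake_measure_cylinder k (A : {set 'I_k.+1}) : atom d A ->
  snake_measure (cylinder d A) = (weight q (r k) k (bits A) / mass k)%:E.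
Proof.
rewrite atom_bits => aA; rewrite -cell_size //.
rewrite /snake_measure /= /distribution /pushforward sampler_cylinder.
have [c0 c12 c1] := cell_bounds (bits A) k.
by apply: unif01_itv => // u; exact: agree_cell.
Qed.

End sampling.

(** * Existence and uniqueness *)

Section existence_uniqueness.
Variables (R : realType) (q : R) (d : nat -> bool).
Hypothesis q0 : 0 < q.

Lemma sum_probability_cylinders (mu : probability (borel_filter_space d) R) k :
  (\sum_(A : {set 'I_k.+1} | atom d A) mu (cylinder d A) = 1)%E.
Proof.
rewrite bigfs ?index_enum_uniq // => [|A _]; last by rewrite mem_index_enum.
rewrite -(@measure_fin_bigcup _ R (borel_filter_space d)) => [||A B _ _|A _].
- have -> : \bigcup_(A in [set` @atom k d]) cylinder d A = setT.
    by apply/seteqP; split=> // F _; exists (snake_trace k (set_val F)) => //=;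
      exact: atom_trace.
  exact: probability_setT.
- exact: finite_finset.
- by move=> [F [<- <-]].
- exact: measurable_cylinder.
Qed.

(** The weights of all atoms add up to [mass] because the measure that realises
    them is a probability. *)
Lemma sum_weight_atoms (r : nat -> R) k : (forall i, 0 < r i) ->
  (forall i, r i = step q (d i) (r i.+1)) ->
  \sum_(A : {set 'I_k.+1} | atom d A) weight q (r k) k (bits A) = mass q d r k.
Proof.
move=> r0 rS; have := @sum_probability_cylinders (snake_measure q d r) k.
rewrite (eq_bigr _ (fun A aA => snake_measure_cylinder q0 r0 rS aA)).
rewrite sumEFin -mulr_suml => -[/divr1_eq]; exact.
Qed.

(** A cylinder law determines the measure of every cylinder, since the limit
    ratios in it are unique. *)
Lemma has_cylinder_law_unique (mu nu : probability (borel_filter_space d) R) :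
  has_cylinder_law q mu -> has_cylinder_law q nu ->
  forall A : set (borel_filter_space d), measurable A -> nu A = mu A.
Proof.
move=> Hmu Hnu; apply: eq_probability_cylinders => k E aE.
have [rho rhoP ->//] := Hmu k E aE.
have [rho' rhoP' ->//] := Hnu k E aE.
have rhoE F : atom d F -> rho' F = rho F.
  by move=> aF; apply: ratio_cvg_unique (rhoP' F aF) (rhoP F aF).
by rewrite rhoE // (eq_bigr _ rhoE).
Qed.

Lemma has_cylinder_law_exists : has_valleys d ->
  exists mu : probability (borel_filter_space d) R, has_cylinder_law q mu.
Proof.
move=> pk; have [rho rhoP lim_rho] := tail_ratio_limits q0 pk.
have r0 k := (rhoP k).1; have rS k := (rhoP k).2.
exists (snake_measure q d rho) => k E0 aE0.
pose w (A : {set 'I_k.+1}) := weight q (rho k) k (bits A).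
exists (fun A => w A / w E0) => [F aF|E aE].
  exact: ratio_cvg_weight (lim_rho k) aE0 aF.
rewrite snake_measure_cylinder // -mulr_suml sum_weight_atoms //.
rewrite (invfM (mass _ _ _ _)) invrK mulrACA mulVf ?mulr1 // lt0r_neq0 //.
exact: weight_gt0.
Qed.
End existence_uniqueness.

Theorem theorem4p8 (R : realType) (x q : R) :
  0 < x -> irrational x -> 0 < q ->
  (* a measure is a function on all sets, hence the comparison of nu and mu on
     measurable sets only *)
  exists mu : probability (borel_filter_space (cf_snake x)) R,
    has_cylinder_law q mu /\
    forall nu : probability (borel_filter_space (cf_snake x)) R,
      has_cylinder_law q nu ->
      forall A : set (borel_filter_space (cf_snake x)),
        measurable A -> nu A = mu A.
Proof.
move=> _ irr q0.
have [mu Hmu] := has_cylinder_law_exists q0 (cf_snake_valleys irr).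
exists mu; split=> // nu Hnu.
exact: has_cylinder_law_unique Hmu Hnu.
Qed.
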